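(* Let $n\geq 3$ and let $\Gamma=L_2(n)$ be the square lattice graph (which is a hull). (1) If $n$ is a prime power, then the minimum size of a generating set of the hull of $\Gamma$ is $n-1$, and such a minimum generating set is given by the endomorphisms induced by a complete set of $n-1$ mutually orthogonal Latin squares of order $n$. (2) If $n$ is not a prime power, then the hull of $\Gamma$ has a generating set with at most $n(n-1)$ elements.
   Context: $L_2(n)$ has vertex set $\mathbb{Z}_n^2$ (cells of an $n\times n$ array), two vertices adjacent iff they agree in exactly one coordinate (same row or same column). A Latin square $L$ of order $n$ induces an endomorphism of $L_2(n)$ that maps each cell to a fixed cell of a fixed row according to its symbol, so that it collapses exactly the cells carrying the same symbol. For a set $M$ of transformations of the vertex set $V$ (acting on the right), $\mathrm{Gr}(M)$ is the graph on $V$ in which distinct $v,w$ are adjacent iff no $f\in M$ satisfies $vf=wf$. The hull of $\Gamma$ is $\mathrm{Hull}(\Gamma)=\mathrm{Gr}(\mathrm{End}(\Gamma))$; a generating set of the hull of $\Gamma$ is a subset $M\subseteq \mathrm{End}(\Gamma)$ with $\mathrm{Gr}(M)=\mathrm{Hull}(\Gamma)$. *)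

(* Defs.v *)
From mathcomp Require Import all_boot perm matrix.

Set Implicit Arguments.
Unset Strict Implicit.
Unset Printing Implicit Defensive.

(* A finite graph is given by its vertex type and its adjacency relation; two
   graphs on the same vertices are equal when their adjacency relations agree
   pointwise (=2). *)
Section Hull.
Variables (T : finType) (e : rel T).

Definition graph_end : {set {ffun T -> T}} :=
  [set f : {ffun T -> T} | [forall v, forall w, e v w ==> e (f v) (f w)]].

Definition Gr (M : {set {ffun T -> T}}) : rel T :=
  fun v w => (v != w) && [forall f in M, f v != f w].

Definition Hull : rel T := Gr graph_end.

Definition is_hull : Prop := Hull =2 e.

Definition hull_generating (M : {set {ffun T -> T}}) : Prop :=
  M \subset graph_end /\ Gr M =2 Hull.

Definition min_hull_generating_size (m : nat) : Prop :=
  (exists2 M, hull_generating M & #|M| = m) /\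
  (forall M, hull_generating M -> m <= #|M|).

End Hull.

Definition cell (n : nat) : finType := ('I_n * 'I_n)%type.

(* Exclusive or: the cells agree in exactly one coordinate. *)
Definition L2 (n : nat) : rel (cell n) :=
  fun u v => (u.1 == v.1) (+) (u.2 == v.2).
Arguments L2 n u v : clear implicits.

Section LatinSquares.
Variable n : nat.

Definition latin_square (L : 'M['I_n]_n) : Prop :=
  (forall i s, exists! j, L i j = s) /\ (forall j s, exists! i, L i j = s).

Definition orthogonal_squares (A B : 'M['I_n]_n) : Prop :=
  forall s t, exists! c : cell n, A c.1 c.2 = s /\ B c.1 c.2 = t.

Definition MOLS (k : nat) (L : 'I_k -> 'M['I_n]_n) : Prop :=
  (forall a, latin_square (L a)) /\
  (forall a b, a != b -> orthogonal_squares (L a) (L b)).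

(* The transformation induced by L sends a cell with symbol s to the cell in
   column [c s] of row [r]; the row [r] and the bijection [c] from symbols to
   columns are the arbitrary choices involved in the construction. *)
Definition latin_endo (r : 'I_n) (c : {perm 'I_n}) (L : 'M['I_n]_n) :
    {ffun cell n -> cell n} :=
  [ffun x : cell n => (r, c (L x.1 x.2))].

End LatinSquares.

Definition prime_power (n : nat) : Prop :=
  exists p k : nat, [/\ prime p, 0 < k & n = p ^ k].

(* Main.v *)
Require Import Defs.
From mathcomp Require Import all_boot perm matrix.
From mathcomp Require Import ssralg zmodp finalg finfield.

Set Implicit Arguments.
Unset Strict Implicit.
Unset Printing Implicit Defensive.

(* A set M of endomorphisms generates the hull as soon as every pair of
   distinct non-adjacent cells is collapsed by some member of M, and a Latin
   square collapses exactly the pairs of cells carrying the same symbol.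

   Lower bound: fix a cell v and a row i other than that of v.  Each cell of
   row i outside the column of v must be collapsed with v by some f in M, and an
   endomorphism is injective on row i, so that M has at least n - 1 elements.

   Complete MOLS: given v and a row i other than that of v, the n - 1 cells of
   row i that carry the symbol of v in the successive squares are distinct by
   orthogonality, hence exhaust row i outside the column of v.

   Without a field of order n: the squares [rho x + y] over Z_n, where rho sends
   a chosen row i to 0 and the other rows onto the nonzero residues up to one
   of n - 1 cyclic shifts, realize every nonzero difference rho i - rho i';
   there are n (n - 1) of them. *)

Lemma injective_exists_unique (T : finType) (f : T -> T) (y : T) :
  injective f -> exists! x, f x = y.
Proof.
move=> f_inj; exists (invF f_inj y); split; first exact: f_invF.
by move=> x <-; rewrite invF_f.
Qed.

(** * Hulls and collapsed pairs of vertices *)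

Section Hulls.
Variables (T : finType) (e : rel T).
Hypothesis e_irr : irreflexive e.

Lemma sub_Gr_graph_end (M : {set {ffun T -> T}}) v w :
  M \subset graph_end e -> e v w -> Gr M v w.
Proof.
move=> sM evw; apply/andP; split.
  by apply: contraTneq evw => ->; rewrite e_irr.
apply/forall_inP => f /(subsetP sM); rewrite inE => /forallP/(_ v)/forallP/(_ w).
by rewrite evw /=; apply: contraTneq => ->; rewrite e_irr.
Qed.

Lemma Gr_collapsing (M : {set {ffun T -> T}}) :
    M \subset graph_end e ->
    (forall v w, v != w -> ~~ e v w -> exists2 f : {ffun T -> T}, f \in M & f v = f w) ->
  Gr M =2 e.
Proof.
move=> sM colM v w; apply/idP/idP; last exact: sub_Gr_graph_end.
case/andP=> vDw /forall_inP sep; apply/negPn/negP => /(colM _ _ vDw)[f fM fE].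
by have := sep f fM; rewrite fE eqxx.
Qed.

(** Members of [M] are endomorphisms, so the full set [graph_end e] collapses every pair that [M]
    does. *)
Lemma is_hull_collapsing (M : {set {ffun T -> T}}) :
    M \subset graph_end e ->
    (forall v w, v != w -> ~~ e v w -> exists2 f : {ffun T -> T}, f \in M & f v = f w) ->
  is_hull e.
Proof.
move=> sM colM; apply: Gr_collapsing => // v w vDw /(colM _ _ vDw)[f fM fE].
by exists f => //; apply: (subsetP sM).
Qed.

Lemma hull_generating_collapsing (M : {set {ffun T -> T}}) :
    M \subset graph_end e ->
    (forall v w, v != w -> ~~ e v w -> exists2 f : {ffun T -> T}, f \in M & f v = f w) ->
  hull_generating e M.
Proof.
move=> sM colM; split=> // v w.
by rewrite (Gr_collapsing sM colM) (is_hull_collapsing sM colM).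
Qed.

Lemma hull_generating_collapse (M : {set {ffun T -> T}}) v w :
    is_hull e -> hull_generating e M -> v != w -> ~~ e v w ->
  exists2 f : {ffun T -> T}, f \in M & f v = f w.
Proof.
move=> hull_e [_ genM] vDw; rewrite -hull_e -genM /Gr vDw /= negb_forall_in.
by case/exists_inP=> f fM /negPn/eqP fE; exists f.
Qed.

End Hulls.

(** * Latin squares acting on the square lattice *)

Section SquareLattice.
Variable n : nat.

Lemma L2_irr : irreflexive (L2 n).
Proof. by move=> v; rewrite /L2 !eqxx. Qed.

Lemma L2_nonadjacent (v w : cell n) :
  v != w -> ~~ L2 n v w -> (v.1 != w.1) && (v.2 != w.2).
Proof.
by case: v w => [i j] [i' j']; rewrite /L2 -pair_eqE /pair_eq /=; do 2!case: eqP.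
Qed.

Lemma hull_generating_size (M : {set {ffun cell n -> cell n}}) :
  1 < n -> is_hull (L2 n) -> hull_generating (L2 n) M -> n.-1 <= #|M|.
Proof.
move=> n_gt1 hullL genM.
pose i0 := Ordinal (ltnW n_gt1); pose i1 := Ordinal n_gt1; pose v : cell n := (i0, i0).
(* The column where [f] collapses a cell of row [i1] with [v]; the default [i0] is arbitrary. *)
pose col (f : {ffun cell n -> cell n}) := odflt i0 [pick j | f (i1, j) == f v].
suff sub : [set~ i0] \subset [set col f | f in M].
  have := leq_trans (subset_leq_card sub) (leq_imset_card _ _).
  by rewrite cardsC1 card_ord.
apply/subsetP=> j; rewrite !inE => jD0.
have [||f fM fE] := hull_generating_collapse (v := v) (w := (i1, j)) hullL genM.
- by [].
- by rewrite /L2 /= eq_sym (negPf jD0).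
apply/imsetP; exists f => //; rewrite /col; case: pickP => [j' /eqP | /(_ j)]; last first.
  by rewrite fE eqxx.
(* Two distinct cells of row [i1] are adjacent, so [f] cannot send both to [f v]. *)
rewrite fE => fE'; apply/eqP; apply: contraT => /= jDj'.
have /(sub_Gr_graph_end L2_irr genM.1) : L2 n (i1, j) (i1, j').
  by rewrite /L2 /= (negPf jDj').
by case/andP=> _ /forall_inP/(_ f fM); rewrite fE' eqxx.
Qed.

Implicit Types A B : 'M['I_n]_n.

Lemma latin_square_inj A :
    (forall i, injective (A i)) -> (forall j, injective (A^~ j)) ->
  latin_square A.
Proof.
by move=> injr injc; split=> [i|j] s; apply: (injective_exists_unique s).
Qed.

Lemma latin_square_row_inj A i : latin_square A -> injective (A i).
Proof. by case=> latA _ j j' E; have [k [_ u]] := latA i (A i j'); rewrite -(u j) // -(u j'). Qed.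

Lemma latin_square_col_inj A j : latin_square A -> injective (A^~ j).
Proof. by case=> _ latA i i' E; have [k [_ u]] := latA j (A i' j); rewrite -(u i) // -(u i'). Qed.

(** There are as many pairs of symbols as cells, so an injective superposition is bijective. *)
Lemma orthogonal_squares_inj A B :
    (forall c d : cell n, A c.1 c.2 = A d.1 d.2 -> B c.1 c.2 = B d.1 d.2 -> c = d) ->
  orthogonal_squares A B.
Proof.
move=> injAB s t.
have [|c [[Ac Bc] uc]] :=
  @injective_exists_unique _ (fun c : cell n => (A c.1 c.2, B c.1 c.2) : cell n) (s, t).
  by move=> c d [Ec Ed]; apply: injAB.
by exists c; split=> // d [Ad Bd]; apply: uc; rewrite Ad Bd.
Qed.

(** Cells on a common line carry distinct symbols, and distinct cells of row [r] are adjacent. *)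
Lemma latin_endo_graph_end r c A :
  latin_square A -> latin_endo r c A \in graph_end (L2 n).
Proof.
move=> latA; rewrite inE; apply/forallP=> -[i j]; apply/forallP=> -[i' j'].
rewrite /L2 !ffunE /= eqxx (inj_eq perm_inj) /=; apply/implyP.
case: (eqVneq i i') => [<-|iDi']; first by rewrite (inj_eq (latin_square_row_inj latA)).
by case: (eqVneq j j') => // <- _; rewrite (inj_eq (latin_square_col_inj (j := j) latA)).
Qed.

Lemma latin_endo_collapse r c A (v w : cell n) :
  A v.1 v.2 = A w.1 w.2 -> latin_endo r c A v = latin_endo r c A w.
Proof. by rewrite !ffunE => ->. Qed.

Lemma complete_MOLS_collapse (L : 'I_n.-1 -> 'M['I_n]_n) (v w : cell n) :
    MOLS L -> v.1 != w.1 -> v.2 != w.2 ->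
  exists a, L a v.1 v.2 = L a w.1 w.2.
Proof.
case=> latL orthL vDw1 vDw2.
have /fin_all_exists[col colE] a : exists j, L a w.1 j = L a v.1 v.2.
  by have [j []] := (latL a).1 w.1 (L a v.1 v.2); exists j.
have col_inj : injective col.
  move=> a b Eab; apply/eqP; apply: contraT => aDb.
  have [c [_ uc]] := orthL a b aDb (L a v.1 v.2) (L b v.1 v.2).
  (* If [col a = col b], this cell and [v] show the same pair of symbols in [L a] and [L b], though
     their rows differ. *)
  have Ew : c = (w.1, col a) by apply: uc; rewrite /= {2}Eab !colE.
  by rewrite -(uc v) // Ew eqxx in vDw1.
(* The image misses [v.2], since a symbol occurs once in that column; counting then forces
   equality. *)
have /eqP/setP/(_ w.2) : [set col a | a : 'I_n.-1] == [set~ v.2].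
  rewrite eqEcard cardsC1 card_imset // !card_ord leqnn andbT.
  apply/subsetP=> _ /imsetP[a _ ->]; rewrite !inE.
  apply: contraNneq vDw1 => Ea; apply/eqP.
  by apply: (latin_square_col_inj (j := v.2) (latL a)); rewrite /= -(colE a) Ea.
by rewrite !inE eq_sym vDw2 => /imsetP[a _ Ea]; exists a; rewrite Ea colE.
Qed.

Lemma complete_MOLS_generating (L : 'I_n.-1 -> 'M['I_n]_n)
    (r : 'I_n.-1 -> 'I_n) (c : 'I_n.-1 -> {perm 'I_n}) :
  MOLS L ->
  hull_generating (L2 n) [set latin_endo (r a) (c a) (L a) | a : 'I_n.-1].
Proof.
move=> molsL; apply: (hull_generating_collapsing L2_irr).
  by apply/subsetP=> _ /imsetP[a _ ->]; apply/latin_endo_graph_end/molsL.1.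
move=> v w /L2_nonadjacent nadj /nadj/andP[vDw1 vDw2].
have [a Ea] := complete_MOLS_collapse molsL vDw1 vDw2.
by exists (latin_endo (r a) (c a) (L a)); [apply: imset_f | apply: latin_endo_collapse].
Qed.

End SquareLattice.

(** * Complete sets of MOLS from finite fields *)

Section FieldMOLS.
Import GRing.Theory.
Local Open Scope ring_scope.

Lemma finField_MOLS (F : finFieldType) :
  exists L : 'I_#|F|.-1 -> 'M['I_#|F|]_#|F|, MOLS L.
Proof.
pose slope (a : 'I_#|F|.-1) : F := enum_val (cast_ord (esym (cardC1 (0 : F))) a).
have slope_inj : injective slope by move=> a b /enum_val_inj/cast_ord_inj.
have slopeD0 a : slope a != 0.
  by have := enum_valP (cast_ord (esym (cardC1 (0 : F))) a).
have valI : injective (fun i : 'I_#|F| => enum_val i : F) by exact: enum_val_inj.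
exists (fun a => \matrix_(i, j) enum_rank (slope a * enum_val i + enum_val j)).
split=> [a | a b aDb].
  apply: latin_square_inj => [i j j' | j i i']; rewrite !mxE => /enum_rank_inj.
    by move/addrI/valI.
  by move/addIr/(mulfI (slopeD0 a))/valI.
apply: orthogonal_squares_inj => -[i j] [i' j'] /=; rewrite !mxE.
move=> /enum_rank_inj Ea /enum_rank_inj Eb.
have Ei : i = i'.
  apply/valI/(@mulfI _ (slope a - slope b)); first by rewrite subr_eq0 (inj_eq slope_inj).
  (* Subtraction cancels the column terms, leaving row terms scaled by the nonzero
     [slope a - slope b]. *)
  have := congr2 (fun x y => x - y) Ea Eb.
  by rewrite !mulrBl !opprD addrACA subrr addr0 addrACA subrr addr0.
by move: Ea; rewrite Ei => /addrI/valI ->.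
Qed.

End FieldMOLS.

Lemma prime_power_MOLS n :
  prime_power n -> exists L : 'I_n.-1 -> 'M['I_n]_n, MOLS L.
Proof.
case=> p [k [p_pr k_gt0 ->]].
by have [F _ <-] := PrimePowerField p_pr k_gt0; apply: finField_MOLS.
Qed.

(** * Cyclic squares with permuted rows *)

Section RowPermutedCirculants.
Import GRing.Theory.
Local Open Scope ring_scope.
Variable m : nat.

Definition circulant (rho : 'S_m.+2) : 'M['I_m.+2]_m.+2 :=
  \matrix_(i, j) (rho i + j).

Lemma circulant_latin rho : latin_square (circulant rho).
Proof.
apply: latin_square_inj => [i j j' | j i i']; rewrite !mxE; first exact: addrI.
by move/addIr/perm_inj.
Qed.

(** The shift by [x.2] is addition modulo n - 1 on the indices of the rows other than [x.1];
    [lift_perm] turns these into nonzero residues modulo n. *)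
Definition shift_rows (x : 'I_m.+2 * 'I_m.+1) : 'S_m.+2 :=
  lift_perm x.1 ord0 (perm (@addrI _ x.2)).

Lemma shift_rows_collapse (v w : cell m.+2) :
    v.1 != w.1 -> v.2 != w.2 ->
  exists x, circulant (shift_rows x) v.1 v.2 = circulant (shift_rows x) w.1 w.2.
Proof.
move=> /unlift_some[j Ej _] vDw2.
have /unlift_some[l El _] : ord0 != v.2 - w.2 :> 'I_m.+2 by rewrite eq_sym subr_eq0.
(* Row [v.1] goes to 0, so row [w.1] must go to [v.2 - w.2]: the shift [l - j] takes its index [j]
   to [l]. *)
exists (v.1, l - j); rewrite !mxE /shift_rows /= Ej lift_perm_id lift_perm_lift permE.
by rewrite subrK -El subrK add0r.
Qed.

Definition shift_endos : {set {ffun cell m.+2 -> cell m.+2}} :=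
  [set latin_endo ord0 1%g (circulant (shift_rows x)) | x : 'I_m.+2 * 'I_m.+1].

Lemma shift_endos_graph_end : shift_endos \subset graph_end (L2 m.+2).
Proof.
by apply/subsetP=> _ /imsetP[x _ ->]; apply/latin_endo_graph_end/circulant_latin.
Qed.

Lemma shift_endos_collapse (v w : cell m.+2) :
    v != w -> ~~ L2 m.+2 v w ->
  exists2 f : {ffun cell m.+2 -> cell m.+2}, f \in shift_endos & f v = f w.
Proof.
move=> /L2_nonadjacent nadj /nadj/andP[vDw1 vDw2].
have [x Ex] := shift_rows_collapse vDw1 vDw2.
exists (latin_endo ord0 1%g (circulant (shift_rows x))); first exact: imset_f.
exact: latin_endo_collapse.
Qed.

Lemma card_shift_endos : (#|shift_endos| <= m.+2 * m.+1)%N.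
Proof.
by rewrite (leq_trans (leq_imset_card _ _)) // card_prod !card_ord.
Qed.

End RowPermutedCirculants.

Theorem mainTheorem19 (n : nat) (hn : 3 <= n) :
  [/\ is_hull (L2 n),
      prime_power n ->
        [/\ min_hull_generating_size (L2 n) n.-1,
            exists L : 'I_n.-1 -> 'M['I_n]_n, MOLS L
          & forall (L : 'I_n.-1 -> 'M['I_n]_n)
                   (r : 'I_n.-1 -> 'I_n) (c : 'I_n.-1 -> {perm 'I_n}),
              MOLS L ->
              let M := [set latin_endo (r a) (c a) (L a) | a : 'I_n.-1] in
              hull_generating (L2 n) M /\ #|M| = n.-1]
    & ~ prime_power n ->
        exists2 M : {set {ffun cell n -> cell n}},
          hull_generating (L2 n) M & #|M| <= n * n.-1].
Proof.
case: n hn => [|[|m]] // _.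
(* The cyclic squares give both the hull property and the generating set of (2). *)
have endM := @shift_endos_graph_end m; have colM := @shift_endos_collapse m.
have hullL : is_hull (L2 m.+2) := is_hull_collapsing (@L2_irr _) endM colM.
have lower M : hull_generating (L2 m.+2) M -> m.+1 <= #|M|.
  exact: hull_generating_size.
split=> // [ppn | _]; last first.
  exists (shift_endos m); last exact: card_shift_endos.
  exact (hull_generating_collapsing (@L2_irr _) endM colM).
have minM (L : 'I_m.+1 -> 'M['I_m.+2]_m.+2) r c : MOLS L ->
    let M := [set latin_endo (r a) (c a) (L a) | a : 'I_m.+1] in
    hull_generating (L2 m.+2) M /\ #|M| = m.+1.
  move=> molsL M; have genM : hull_generating (L2 m.+2) M.
    exact: complete_MOLS_generating.
  (* The lower bound for generating sets rules out repetitions among the induced endomorphisms. *)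
  split=> //; apply/eqP; rewrite eqn_leq lower // andbT.
  by rewrite (leq_trans (leq_imset_card _ _)) // card_ord.
have [L molsL] := prime_power_MOLS ppn.
split=> //; last by exists L.
split=> //; have [genM cardM] := minM L (fun=> ord0) (fun=> 1%g) molsL.
by eexists; [exact: genM | exact: cardM].
Qed.
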